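(* For each odd integer $n\ge 3$ there exists a saturated pure partial plane of order $n$ in which no point lies on more than $2$ lines.
   Context: A pure partial plane of order $n$ and size $s$ is a set $X$ of $n^2+n+1$ points together with a collection of $s$ distinct lines, each line being a subset of $X$ of cardinality $n+1$, such that any two distinct lines intersect in exactly one point. It is saturated if no $(n+1)$-subset of $X$ other than the existing lines meets every existing line in exactly one point (so no line can be added keeping it a pure partial plane). *)

(* Defs.v *)
From mathcomp Require Import all_boot.

Set Implicit Arguments.
Unset Strict Implicit.
Unset Printing Implicit Defensive.

(* The finType T is the point set X; the lines form a set L of subsets of T, so
   they are automatically distinct. *)
Definition pure_partial_plane (n s : nat) (T : finType) (L : {set {set T}}) : Prop :=
  [/\ #|T| = n ^ 2 + n + 1,
      #|L| = s,
      (forall l : {set T}, l \in L -> #|l| = n + 1)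
    & (forall l m : {set T}, l \in L -> m \in L -> l <> m -> #|l :&: m| = 1)].

Definition saturated (n : nat) (T : finType) (L : {set {set T}}) : Prop :=
  forall A : {set T}, #|A| = n + 1 -> A \notin L ->
    ~ (forall l : {set T}, l \in L -> #|A :&: l| = 1).

(* Main.v *)
Require Import Defs.
From mathcomp Require Import all_boot.
From mathcomp Require Import zify.

(** Take the stars of the complete graph on [n + 2] vertices as lines: the points
are its ['C(n + 2, 2)] edges together with enough isolated points to reach
[n ^ 2 + n + 1].  A set meeting every star exactly once contributes [n + 2]
incidences, but each of its points lies on two lines or on none, so the number of
incidences is even, which is impossible for odd [n]. *)

Definition edge (V : finType) := {e : {set V} | #|e| == 2}.

Definition point (V : finType) (k : nat) : finType := (edge V + 'I_k)%type.

(** Isolated points get the empty set of ends, so that incidence with a star is a single membership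
    test for all points. *)
Definition ends {V : finType} {k : nat} (x : point V k) : {set V} :=
  if x is inl e then val e else set0.

Definition star (V : finType) (k : nat) (v : V) : {set point V k} :=
  [set x | v \in ends x].

Section Stars.

Variables (V : finType) (k : nat).
Implicit Types (v w : V) (x : point V k).

Lemma card_point : #|point V k| = 'C(#|V|, 2) + k.
Proof. by rewrite card_sum card_ord card_sig -cardsE card_draws. Qed.

Lemma card_ends x : #|ends x| = if x is inl _ then 2 else 0.
Proof. by case: x => [e|j] /=; rewrite ?cards0 //; apply/eqP/(valP e). Qed.

(** An edge at [v] is determined by its other end, which ranges over all vertices except [v];
    isolated points lie in no star. *)
Lemma card_star v : #|star V k v| = #|V|.-1.
Proof.
have imE : val @: [set e : edge V | v \in val e] = (fun w => [set v; w]) @: [set~ v].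
  apply/setP=> A; apply/imsetP/imsetP => [[e] | [w]].
    rewrite inE => ve ->; have /cards2P[a [b [ab eE]]] := valP e.
    move: ve; rewrite eE !inE => /orP[] /eqP->.
      by exists b => //; rewrite !inE eq_sym.
    by exists a; rewrite ?inE // setUC.
  rewrite !inE => wv ->.
  have cA : #|[set v; w]| == 2 by rewrite cards2 (eq_sym v) wv.
  by exists (Sub [set v; w] cA : edge V); rewrite // inE /= !inE eqxx.
have -> : star V k v = inl @: [set e : edge V | v \in val e].
  apply/setP=> -[e|j]; rewrite !inE.
    by rewrite (mem_imset _ _ (@inl_inj _ _)) inE.
  by apply/esym/imsetP => -[].
rewrite (card_imset _ (@inl_inj _ _)) -(card_imset _ val_inj) imE.
rewrite card_in_imset ?cardsC1 // => a b; rewrite !inE => av bv /setP/(_ a).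
by rewrite !inE eqxx (negPf av) => /esym/eqP.
Qed.

Lemma card_starI v w : v != w -> #|star V k v :&: star V k w| = 1.
Proof.
move=> vw; have cA : #|[set v; w]| == 2 by rewrite cards2 vw.
suff -> : star V k v :&: star V k w = [set inl (Sub [set v; w] cA : edge V)] by rewrite cards1.
apply/setP=> -[e|j]; rewrite !inE //=; apply/andP/eqP => [[ve we]|[->]]; last first.
  by rewrite /= !inE !eqxx orbT.
congr inl; apply/val_inj/esym/eqP => /=.
(* A common edge contains [[set v; w]] and has the same size 2, so it equals it. *)
by rewrite eqEcard (eqP cA) (eqP (valP e)) subUset !sub1set ve we.
Qed.

(** Every star through [x] is centred at an end of [x], and [x] has two ends or none. *)
Lemma card_stars_through x :
  #|[set l in star V k @: setT | x \in l]| <= 2.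
Proof.
apply: (@leq_trans #|star V k @: ends x|).
  apply/subset_leq_card/subsetP => _ /setIdP[/imsetP[v _ ->]].
  by rewrite inE; apply: imset_f.
by apply: leq_trans (leq_imset_card _ _) _; rewrite card_ends; case: x.
Qed.

Lemma even_star_incidences (A : {set point V k}) :
  ~~ odd (\sum_v #|A :&: star V k v|).
Proof.
(* Double counting of the pairs of a point of [A] and one of its ends. *)
have -> : \sum_v #|A :&: star V k v| = \sum_(x in A) #|ends x|.
  under eq_bigr => v _.
    rewrite -sum1_card (eq_bigl (fun x => (x \in A) && (v \in ends x))).
      rewrite big_mkcondr; over.
    by move=> x; rewrite !inE.
  rewrite exchange_big; apply: eq_bigr => x _.
  by rewrite -big_mkcond sum1_card.
rewrite -dvdn2; apply: dvdn_sum => x _.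
by rewrite card_ends; case: x.
Qed.

End Stars.

Theorem theorem3 (n : nat) (n_odd : odd n) (n_ge3 : 3 <= n) :
  exists (s : nat) (T : finType) (L : {set {set T}}),
    [/\ pure_partial_plane n s L,
        saturated n L
      & forall x : T, #|[set l in L | x \in l]| <= 2].
Proof.
pose k := n ^ 2 + n + 1 - 'C(n.+2, 2).
pose L := star 'I_n.+2 k @: setT.
exists #|L|, (point 'I_n.+2 k), L; split; last exact: card_stars_through.
- split=> //.
  (* The subtraction in [k] does not truncate: [(n + 2) * (n + 1) <= 2 * (n ^ 2 + n + 1)] reduces to
     [n <= n ^ 2]. *)
  + by rewrite card_point card_ord subnKC // bin2 -mulnn; nia.
  + by move=> _ /imsetP[v _ ->]; rewrite card_star card_ord addn1.
  + move=> _ _ /imsetP[v _ ->] /imsetP[w _ ->] vw.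
    by apply: card_starI; apply/eqP => vwE; apply: vw; rewrite vwE.
- move=> A _ _ A1; have := even_star_incidences 'I_n.+2 k A.
  under eq_bigr => v _ do rewrite A1 ?imset_f //.
  by rewrite sum1_card card_ord /= n_odd.
Qed.
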